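(* Let $(s^0_{ijk})$ be an observed contingency table with grand total $N$ and all $B$-marginals positive, and let $c_{ij}=s^0_{ij+}/s^0_{+j+}$ be its conditional frequencies. Write $c_{ij}=g_{ij}/h_{ij}$ with $g_{ij}\ge 0$, $h_{ij}\ge1$ relatively prime integers, and let $m_j$ be the least common multiple of $h_{1j},\dots,h_{Ij}$. The following statements are equivalent: (a) $\mathcal F_{A|B}$ coincides with $\mathcal F_{AB}$; (b) the equation $\sum_{j=1}^{J} m_j x_j=N$ has only one positive integer solution $(x_1,\dots,x_J)$.
   Context: Let $X_1,\dots,X_r$ be categorical variables with finitely many levels each. Let $A,B$ be disjoint proper subsets of $\{X_1,\dots,X_r\}$ and let $C$ be the set of the remaining variables (possibly empty). Regard $A,B,C$ as three compound categorical variables with $I$, $J$, $K$ levels respectively ($K=1$ if $C=\emptyset$). An $r$-way contingency table is identified with a 3-way array $(s_{ijk})$ of nonnegative integers, $1\le i\le I$, $1\le j\le J$, $1\le k\le K$. A subscript $+$ denotes summation over that index. $\mathcal F_{A|B}$ is the set of all tables $(s_{ijk})$ of nonnegative integers with $\sum_{i,j,k}s_{ijk}=N$, $s_{+j+}>0$ for all $j$, and $s_{ij+}/s_{+j+}=c_{ij}$ for all $i,j$. $\mathcal F_{AB}$ is the set of all tables $(s_{ijk})$ of nonnegative integers having the observed $[AB]$ marginal, i.e. $s_{ij+}=s^0_{ij+}$ for all $i,j$. *)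

(* Defs.v *)
From HB Require Import structures.
From mathcomp Require Import all_boot all_order all_algebra.

Set Implicit Arguments.
Unset Strict Implicit.
Unset Printing Implicit Defensive.

Import GRing.Theory.

(* The categorical variables are indexed by 'I_r, variable v having d v levels.
   A level of the compound variable S is a choice of one level for each v in S;
   in particular the compound variable set0 has exactly one level. *)
Definition level (r : nat) (d : 'I_r -> nat) (S : {set 'I_r}) : finType :=
  {dffun forall v : {v : 'I_r | v \in S}, 'I_(d (val v))}.

Definition table (I J K : finType) := {ffun I * J * K -> nat}.

Section Tables.
Variables I J K : finType.
Implicit Types s : table I J K.

Definition grand_total s : nat := \sum_i \sum_j \sum_k s (i, j, k).

(* s_{ij+} *)
Definition marginAB s (i : I) (j : J) : nat := \sum_k s (i, j, k).

(* s_{+j+} *)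
Definition marginB s (j : J) : nat := \sum_i \sum_k s (i, j, k).

(* s_{ij+} / s_{+j+} *)
Definition cond_freq s (i : I) (j : J) : rat :=
  ((marginAB s i j)%:R / (marginB s j)%:R)%R.

(* F_{A|B} *)
Definition fiber_cond (N : nat) (c : I -> J -> rat) : {pred table I J K} :=
  [pred s | [&& grand_total s == N,
                [forall j, 0 < marginB s j] &
                [forall i, forall j, cond_freq s i j == c i j]]].

(* F_{AB}, for the observed table s0 *)
Definition fiber_marg (s0 : table I J K) : {pred table I J K} :=
  [pred s | [forall i, forall j, marginAB s i j == marginAB s0 i j]].

End Tables.

(* m_j, the least common multiple of the h_{ij} over i *)
Definition lcm_den (I J : finType) (h : I -> J -> nat) (j : J) : nat :=
  \big[lcmn/1]_i h i j.

(* Main.v *)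
Require Import Defs.
From HB Require Import structures.
From mathcomp Require Import all_boot all_order all_algebra.

Set Implicit Arguments.
Unset Strict Implicit.
Unset Printing Implicit Defensive.

Import GRing.Theory Num.Theory.

(** Why the theorem holds.  A column [j] with [AB] margins [a_i] and [B] margin
    [b] has conditional frequencies [g_ij / h_ij] exactly when
    [a_i * h_ij = g_ij * b] for all [i].  The fractions are reduced, so every
    [h_ij] divides [b], hence so does their least common multiple [m_j]: such a
    column is [x_j] times the smallest one, which has [B] margin [m_j] and [AB]
    margins [g_ij * (m_j / h_ij)] ([unit_margin], [margin_multiplier]).
    The tables of [F_{A|B}] thus have [AB] margins parametrised by the positive
    [x] with [\sum_j m_j x_j = N], and each such [x] occurs, since all the mass
    can be put at a single level of [C] ([fiber_cond_solution],
    [fiber_cond_realize]).  The observed margins are those of one solution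
    [x0], and different solutions give different [B] margins, hence different
    [AB] margins.  So every table of [F_{A|B}] has the observed [AB] margins
    exactly when [x0] is the only solution; the inclusion of [F_{AB}] in
    [F_{A|B}] always holds ([fiber_marg_sub_cond]). *)

Section Margins.
Variables I J K : finType.
Implicit Types s : table I J K.

Lemma marginB_sum s j : marginB s j = \sum_i marginAB s i j.
Proof. by []. Qed.

Lemma grand_total_sum s : grand_total s = \sum_j marginB s j.
Proof. by rewrite /grand_total exchange_big. Qed.

Lemma fiber_marg_sub_cond s0 s :
  (forall j, 0 < marginB s0 j) -> s \in fiber_marg s0 ->
  s \in fiber_cond (grand_total s0) (cond_freq s0).
Proof.
move=> s0_gt0 /forallP sE.
have eqAB i j : marginAB s i j = marginAB s0 i j.
  by move/forallP: (sE i) => /(_ j) /eqP.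
have eqB j : marginB s j = marginB s0 j.
  by rewrite !marginB_sum; apply: eq_bigr => i _.
apply/and3P; split.
- by rewrite !grand_total_sum; apply/eqP/eq_bigr => j _.
- by apply/forallP => j; rewrite eqB.
- apply/forallP => i; apply/forallP => j.
  by rewrite /cond_freq eqAB eqB.
Qed.

Lemma cond_freq_fracE s i j p q :
    0 < marginB s j -> 0 < q ->
  (cond_freq s i j == (p%:R / q%:R)%R) = (marginAB s i j * q == p * marginB s j).
Proof.
move=> b_gt0 q_gt0; rewrite /cond_freq eqr_div ?pnatr_eq0 -?lt0n //.
by rewrite -!natrM eqr_nat.
Qed.

End Margins.

Section ReducedFrequencies.
Variables (I J : finType) (g h : I -> J -> nat).
Hypothesis h_gt0 : forall i j, 0 < h i j.
Hypothesis gh_coprime : forall i j, coprime (g i j) (h i j).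

(** The [AB] margins of the smallest column with conditional frequencies
    [g i j / h i j], whose [B] margin is [lcm_den h j]. *)
Definition unit_margin i j := g i j * (lcm_den h j %/ h i j).

Lemma lcm_den_gt0 j : 0 < lcm_den h j.
Proof.
rewrite /lcm_den; elim/big_ind: _ => // m n m_gt0 n_gt0.
by rewrite lcmn_gt0 m_gt0.
Qed.

Lemma dvdn_lcm_den i j : h i j %| lcm_den h j.
Proof. exact: (biglcmn_sup i). Qed.

Lemma unit_margin_frac i j : unit_margin i j * h i j = g i j * lcm_den h j.
Proof. by rewrite -mulnA divnK ?dvdn_lcm_den. Qed.

Section Table.
Variables (K : finType) (s : table I J K).
Hypothesis s_gt0 : forall j, 0 < marginB s j.
Hypothesis s_freq : forall i j, cond_freq s i j = ((g i j)%:R / (h i j)%:R)%R.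

(** Coprimality turns [a * h = g * b] into [h %| b], for each [h] of a column,
    hence for their least common multiple. *)
Lemma lcm_den_dvd_marginB j : lcm_den h j %| marginB s j.
Proof.
apply/dvdn_biglcmP => i _.
have /eqP := s_freq i j; rewrite cond_freq_fracE // => /eqP abE.
have : h i j %| g i j * marginB s j by rewrite -abE dvdn_mull.
by rewrite Gauss_dvdr // coprime_sym.
Qed.

Lemma margin_multiplier :
  exists x : {ffun J -> nat}, forall j,
    [/\ 0 < x j, marginB s j = lcm_den h j * x j
      & forall i, marginAB s i j = unit_margin i j * x j].
Proof.
exists [ffun j => marginB s j %/ lcm_den h j] => j; rewrite ffunE.
have m_dvd := lcm_den_dvd_marginB j; have m_gt0 := lcm_den_gt0 j.
have bE : marginB s j = lcm_den h j * (marginB s j %/ lcm_den h j).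
  by rewrite mulnC divnK.
split=> // [|i]; first by rewrite divn_gt0 // dvdn_leq.
have /eqP := s_freq i j; rewrite cond_freq_fracE // => /eqP abE.
apply/eqP; rewrite -(eqn_pmul2r (h_gt0 i j)) abE mulnAC unit_margin_frac.
by rewrite -mulnA -bE.
Qed.

(** The frequencies of a column sum to 1; the existence of one table with these
    frequencies is what guarantees it. *)
Lemma sum_unit_margin j : \sum_i unit_margin i j = lcm_den h j.
Proof.
have [x /(_ j) [x_gt0 bE aE]] := margin_multiplier.
apply/eqP; rewrite -(eqn_pmul2r x_gt0) big_distrl /= -bE marginB_sum.
by apply/eqP/eq_bigr => i _; rewrite aE.
Qed.

End Table.

Section Fiber.
Variables (K : finType) (N : nat) (s0 : table I J K).
Hypothesis s0_gt0 : forall j, 0 < marginB s0 j.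
Hypothesis s0_freq : forall i j, cond_freq s0 i j = ((g i j)%:R / (h i j)%:R)%R.

Lemma fiber_cond_solution (s : table I J K) :
    s \in fiber_cond N (cond_freq s0) ->
  exists x : {ffun J -> nat},
    [/\ forall j, 0 < x j, \sum_j lcm_den h j * x j = N
      & forall i j, marginAB s i j = unit_margin i j * x j].
Proof.
case/and3P => /eqP sN /forallP s_gt0 /forallP s_freq.
have sE i j : cond_freq s i j = ((g i j)%:R / (h i j)%:R)%R.
  by rewrite -s0_freq; move/forallP: (s_freq i) => /(_ j) /eqP.
have [x xP] := margin_multiplier s_gt0 sE.
exists x; split=> [j||i j]; try by case: (xP j).
by rewrite -sN grand_total_sum; apply: eq_bigr => j _; case: (xP j).
Qed.

(** Conditional frequencies do not constrain the distribution over [C], so the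
    whole mass goes to the level [k0]. *)
Lemma fiber_cond_realize (k0 : K) (x : J -> nat) :
    (forall j, 0 < x j) -> \sum_j lcm_den h j * x j = N ->
  exists2 s : table I J K, s \in fiber_cond N (cond_freq s0)
    & forall j, marginB s j = lcm_den h j * x j.
Proof.
move=> x_gt0 xN.
pose s : table I J K :=
  [ffun t => if t.2 == k0 then unit_margin t.1.1 t.1.2 * x t.1.2 else 0].
have aE i j : marginAB s i j = unit_margin i j * x j.
  rewrite /marginAB (bigD1 k0) //= ffunE eqxx big1 ?addn0 // => k /negPf kN.
  by rewrite ffunE /= kN.
have bE j : marginB s j = lcm_den h j * x j.
  rewrite marginB_sum -(sum_unit_margin s0_gt0 s0_freq) big_distrl /=.
  by apply: eq_bigr => i _.
have b_gt0 j : 0 < marginB s j by rewrite bE muln_gt0 lcm_den_gt0 x_gt0.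
exists s => //; apply/and3P; split.
- by rewrite grand_total_sum -xN; apply/eqP/eq_bigr => j _.
- exact/forallP.
- apply/forallP => i; apply/forallP => j; rewrite s0_freq cond_freq_fracE //.
  by rewrite aE bE mulnAC unit_margin_frac mulnA.
Qed.

Lemma fiber_cond_eq_margP (k0 : K) :
    grand_total s0 = N ->
  fiber_cond N (cond_freq s0) =i fiber_marg s0 <->
  exists! x : {ffun J -> nat},
    (forall j, 0 < x j) /\ \sum_j lcm_den h j * x j = N.
Proof.
move=> s0N.
have s0_in : s0 \in fiber_cond N (cond_freq s0).
  rewrite -s0N; apply: fiber_marg_sub_cond => //.
  by apply/forallP => i; apply/forallP => j.
split=> [eq_fib | [x0 [_ x0_uniq]] s].
- have [x0 [x0_gt0 x0N a0E]] := fiber_cond_solution s0_in.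
  exists x0; split=> // x [x_gt0 xN].
  have [s s_in bE] := fiber_cond_realize k0 x_gt0 xN.
  move: s_in; rewrite eq_fib => /forallP sE.
  apply/ffunP => j; apply/eqP.
  rewrite -(eqn_pmul2l (lcm_den_gt0 j)) -bE.
  rewrite -(sum_unit_margin s0_gt0 s0_freq) big_distrl marginB_sum /=.
  apply/eqP/eq_bigr => i _; rewrite -a0E.
  by move/forallP: (sE i) => /(_ j) /eqP.
- apply/idP/idP => [s_in |]; last by rewrite -s0N; apply: fiber_marg_sub_cond.
  have [x [x_gt0 xN aE]] := fiber_cond_solution s_in.
  have [y [y_gt0 yN a0E]] := fiber_cond_solution s0_in.
  have xy : x = y by rewrite -(x0_uniq x) // (x0_uniq y).
  by apply/forallP => i; apply/forallP => j; rewrite aE a0E xy.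
Qed.

End Fiber.
End ReducedFrequencies.

Theorem corollary2p2 (r : nat) (d : 'I_r -> nat)
    (d_gt0 : forall v : 'I_r, 0 < d v)
    (A B : {set 'I_r})
    (A_proper : A \proper [set: 'I_r]) (B_proper : B \proper [set: 'I_r])
    (AB_disjoint : [disjoint A & B])
    (s0 : table (level d A) (level d B) (level d (~: (A :|: B))))
    (N : nat) (s0_total : grand_total s0 = N)
    (s0_marginB : forall j : level d B, 0 < marginB s0 j)
    (g h : level d A -> level d B -> nat)
    (h_gt0 : forall (i : level d A) (j : level d B), 0 < h i j)
    (gh_coprime : forall (i : level d A) (j : level d B),
       coprime (g i j) (h i j))
    (c_frac : forall (i : level d A) (j : level d B),
       cond_freq s0 i j = ((g i j)%:R / (h i j)%:R)%R) :
  fiber_cond N (cond_freq s0) =i fiber_marg s0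
  <->
  exists! x : {ffun level d B -> nat},
    (forall j : level d B, 0 < x j) /\
    \sum_(j : level d B) lcm_den h j * x j = N.
Proof.
(* The level of C choosing 0 for every variable; for empty C it is the only one. *)
pose k0 : level d (~: (A :|: B)) := [ffun v => Ordinal (d_gt0 (val v))].
exact: (fiber_cond_eq_margP h_gt0 gh_coprime s0_marginB c_frac k0 s0_total).
Qed.
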